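(* Let $W$ be a tournament kernel on a probability space $(\mathcal S,\mu)$. The following are equivalent: (1) $W$ is irreducible; (2) $W$ is strongly connected; (3) there is no measurable $B\subseteq\mathcal S$ with $0<\mu(B)<1$ and $\mu(N(B)\setminus B)=0$; (4) there is no measurable $B\subseteq\mathcal S$ with $0<\mu(B)<1$ and $\int_{B\times\mathcal S}W(x,y)\,d\mu(x)d\mu(y)=\frac{\mu(B)^2}{2}$.
   Context: A tournament kernel on $(\mathcal S,\mu)$ is a measurable $W:\mathcal S^2\to[0,1]$ with $W(x,y)+W(y,x)=1$ for a.e. $(x,y)$. $W$ is reducible if there is a measurable $B$ with $0<\mu(B)<1$ such that $W(x,y)=1$ for a.e. $(x,y)\in B\times(\mathcal S\setminus B)$; otherwise irreducible. For measurable $B$, $N(B)=\{y\in\mathcal S:\int_BW(x,y)\,d\mu(x)>0\}$, $N^1=N$, $N^m(B)=N(N^{m-1}(B))$; for a point $x$, $N(\{x\})=\{y:W(x,y)>0\}$ and $N^m(\{x\})=N^{m-1}(N(\{x\}))$. $W$ is strongly connected if for a.e. $x\in\mathcal S$ the set $A(x)=\bigcup_{i\ge1}N^i(\{x\})$ has $\mu(A(x))=1$. *)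

(* Defs.v *)
From HB Require Import structures.
From mathcomp Require Import all_boot all_order all_algebra.
From mathcomp Require Import all_classical all_reals all_analysis.

Set Implicit Arguments.
Unset Strict Implicit.
Unset Printing Implicit Defensive.

Import Order.TTheory GRing.Theory Num.Theory.

Local Open Scope classical_set_scope.
Local Open Scope ring_scope.

Definition tournament_kernel (d : measure_display) (S : measurableType d)
    (R : realType) (mu : probability S R) (W : S * S -> R) : Prop :=
  [/\ measurable_fun [set: S * S] W,
      forall p, 0 <= W p <= 1 &
      {ae (mu \x mu)%E, forall p, W (p.1, p.2) + W (p.2, p.1) = 1}].

Definition reducible (d : measure_display) (S : measurableType d)
    (R : realType) (mu : probability S R) (W : S * S -> R) : Prop :=
  exists B : set S,
    [/\ measurable B, (0 < mu B < 1)%E &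
        {ae (mu \x mu)%E, forall p, (B `*` ~` B) p -> W p = 1}].

Definition irreducible (d : measure_display) (S : measurableType d)
    (R : realType) (mu : probability S R) (W : S * S -> R) : Prop :=
  ~ reducible mu W.

Definition out_set (d : measure_display) (S : measurableType d)
    (R : realType) (mu : probability S R) (W : S * S -> R)
    (B : set S) : set S :=
  [set y | (0 < \int[mu]_(x in B) (W (x, y))%:E)%E].

(* The out-neighbourhood of a point is defined pointwise; it is not
   [out_set mu W [set x]], which is empty when [set x] is a null set. *)
Definition out_pt (d : measure_display) (S : measurableType d)
    (R : realType) (W : S * S -> R) (x : S) : set S :=
  [set y | 0 < W (x, y)].

(* N^m({x}) = N^(m-1)(N({x})), meaningful for m >= 1 only. *)
Definition out_pt_iter (d : measure_display) (S : measurableType d)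
    (R : realType) (mu : probability S R) (W : S * S -> R)
    (m : nat) (x : S) : set S :=
  iter m.-1 (out_set mu W) (out_pt W x).

Definition reachable (d : measure_display) (S : measurableType d)
    (R : realType) (mu : probability S R) (W : S * S -> R) (x : S) : set S :=
  \bigcup_(i in [set i | (1 <= i)%N]) out_pt_iter mu W i x.

Definition strongly_connected (d : measure_display) (S : measurableType d)
    (R : realType) (mu : probability S R) (W : S * S -> R) : Prop :=
  {ae mu, forall x, mu (reachable mu W x) = 1%E}.

(* Main.v *)
Require Import Defs.
From HB Require Import structures.
From mathcomp Require Import all_boot all_order all_algebra.
From mathcomp Require Import all_classical all_reals all_analysis.
From mathcomp Require Import measurable_realfun lra.

Set Implicit Arguments.
Unset Strict Implicit.
Unset Printing Implicit Defensive.

Import Order.TTheory GRing.Theory Num.Theory.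

Local Open Scope classical_set_scope.
Local Open Scope ring_scope.

(** For measurable [A] and [C] let [flow A C] be the integral of [W] over
    [A `*` C].  Swapping coordinates, the tournament identity gives
    [flow A C + flow C A = mu A * mu C]; in particular [flow B B] is half of
    [mu B ^+ 2].  Hence each of the sets [B] excluded in (1), (3) and (4) exists
    iff some [B] with [0 < mu B < 1] has no flow to its complement (for (1), up
    to exchanging [B] and its complement).

    If such a [B] exists, almost every point of [B] only reaches points of [B]
    up to a null set.  Conversely [reachable mu W x] contains its
    out-neighbourhood, so it has no flow to its complement; in the irreducible
    case its measure is 0 or 1, and 0 is excluded for almost every [x], since the
    set [Z] of points without out-neighbours has [mu Z ^+ 2 / 2 = flow Z Z = 0]. *)

(** * Vanishing of integrals of nonnegative functions *)

Section null_integral.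
Local Open Scope ereal_scope.
Context d (T : measurableType d) (R : realType).
Variable mu : {measure set T -> \bar R}.

Lemma ge0_integral_eq0P (D : set T) (f : T -> \bar R) :
  measurable D -> measurable_fun D f -> (forall x, 0 <= f x) ->
  \int[mu]_(x in D) f x = 0 <-> mu (D `&` [set x | 0 < f x]) = 0.
Proof.
move=> mD mf f0.
(* In this form the set is the exceptional set of the a.e. equality of [f] and 0 on [D]. *)
rewrite (_ : D `&` [set x | 0 < f x] = ~` [set x | D x -> f x = 0]).
  rewrite -negligibleP; last first.
    rewrite (_ : ~` _ = D `&` [set x | f x != 0]); first exact: emeasurable_neq.
    apply/seteqP; split => x /=; first by move=> /not_implyP[? /eqP].
    by move=> [Dx /eqP fx]; exact/not_implyP.
  rewrite (eq_integral (fun x => `|f x|)); last by move=> x _; rewrite gee0_abs.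
  exact: (ae_eq_integral_abs mu mD mf).
apply/seteqP; split => x /=.
  by move=> [Dx fx]; apply/not_implyP; split => //; apply/eqP; rewrite gt_eqF.
by move=> /not_implyP[Dx /eqP fx]; split => //; rewrite lt0e fx f0.
Qed.

End null_integral.

(** * Tonelli's theorem on rectangles, and measurability of section integrals *)

Section tonelli_rectangles.
Local Open Scope ereal_scope.
Context d1 d2 (T1 : measurableType d1) (T2 : measurableType d2) (R : realType).
Variable m1 : {sigma_finite_measure set T1 -> \bar R}.
Variable m2 : {sigma_finite_measure set T2 -> \bar R}.
Variable f : T1 * T2 -> \bar R.
Hypothesis mf : measurable_fun setT f.
Hypothesis f0 : forall p, 0 <= f p.
Variables (A : set T1) (B : set T2).
Hypotheses (mA : measurable A) (mB : measurable B).

Let mg : measurable_fun setT (f \_ (A `*` B)).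
Proof.
apply/(measurable_restrictT _ _).1; first exact: measurableX.
exact: measurable_funTS.
Qed.

Let g0 p : 0 <= (f \_ (A `*` B)) p.
Proof. by rewrite patchE; case: ifP. Qed.

Lemma rect_tonelli1 :
  \int[m1 \x m2]_(p in A `*` B) f p = \int[m1]_(x in A) \int[m2]_(y in B) f (x, y).
Proof.
rewrite integral_mkcond fubini_tonelli1// [RHS]integral_mkcond.
apply: eq_integral => x _; rewrite /fubini_F patchE; case: ifPn => xA.
  rewrite [RHS]integral_mkcond; apply: eq_integral => y _.
  by rewrite !patchE in_setX xA.
by apply: integral0_eq => y _; rewrite patchE in_setX (negbTE xA).
Qed.

Lemma rect_tonelli2 :
  \int[m1 \x m2]_(p in A `*` B) f p = \int[m2]_(y in B) \int[m1]_(x in A) f (x, y).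
Proof.
rewrite integral_mkcond fubini_tonelli2// [RHS]integral_mkcond.
apply: eq_integral => y _; rewrite /fubini_G patchE; case: ifPn => yB.
  rewrite [RHS]integral_mkcond; apply: eq_integral => x _.
  by rewrite !patchE in_setX yB andbT.
by apply: integral0_eq => x _; rewrite patchE in_setX (negbTE yB) andbF.
Qed.

End tonelli_rectangles.

Section tonelli_sections.
Local Open Scope ereal_scope.
Context d1 d2 (T1 : measurableType d1) (T2 : measurableType d2) (R : realType).
Variable m1 : {sigma_finite_measure set T1 -> \bar R}.
Variable m2 : {sigma_finite_measure set T2 -> \bar R}.
Variable f : T1 * T2 -> \bar R.
Hypothesis mf : measurable_fun setT f.
Hypothesis f0 : forall p, 0 <= f p.

Lemma measurable_fun_section_integral1 (B : set T2) : measurable B ->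
  measurable_fun setT (fun x => \int[m2]_(y in B) f (x, y)).
Proof.
move=> mB; rewrite (_ : (fun x => _) = fubini_F m2 (f \_ (setT `*` B))).
  apply: measurable_fun_fubini_tonelli_F => [|p]; last by rewrite patchE; case: ifP.
  apply/(measurable_restrictT _ _).1; first exact: measurableX.
  exact: measurable_funTS.
apply/funext => x; rewrite /fubini_F [LHS]integral_mkcond.
by apply: eq_integral => y _; rewrite !patchE in_setX in_setT.
Qed.

Lemma measurable_fun_section_integral2 (A : set T1) : measurable A ->
  measurable_fun setT (fun y => \int[m1]_(x in A) f (x, y)).
Proof.
move=> mA; rewrite (_ : (fun y => _) = fubini_G m1 (f \_ (A `*` setT))).
  apply: measurable_fun_fubini_tonelli_G => [|p]; last by rewrite patchE; case: ifP.
  apply/(measurable_restrictT _ _).1; first exact: measurableX.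
  exact: measurable_funTS.
apply/funext => y; rewrite /fubini_G [LHS]integral_mkcond.
by apply: eq_integral => x _; rewrite !patchE in_setX in_setT andbT.
Qed.

End tonelli_sections.

Lemma measurable_comp_swap d1 d2 d3 (T1 : measurableType d1)
    (T2 : measurableType d2) (T3 : measurableType d3) (f : T1 * T2 -> T3) :
  measurable_fun setT f -> measurable_fun setT (fun p => f (p.2, p.1)).
Proof.
by move=> mf; apply: (measurableT_comp mf); exact: measurable_swap.
Qed.

(** Expanding the two sides by Tonelli in opposite orders yields the same iterated integral. *)
Lemma rect_integral_swap d (T : measurableType d) (R : realType)
    (m : {sigma_finite_measure set T -> \bar R}) (f : T * T -> \bar R)
    (A B : set T) :
  measurable_fun setT f -> (forall p, (0 <= f p)%E) -> measurable A -> measurable B ->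
  (\int[m \x m]_(p in A `*` B) f (p.2, p.1) = \int[m \x m]_(p in B `*` A) f p)%E.
Proof.
move=> mf f0 mA mB; rewrite rect_tonelli1//; first by rewrite rect_tonelli2.
exact: measurable_comp_swap.
Qed.

(** * Flow between sets, and its link with reducibility *)

Section tournament_kernel.
Context d (S : measurableType d) (R : realType).
Variables (mu : probability S R) (W : S * S -> R).
Hypothesis hW : tournament_kernel mu W.
Local Open Scope ereal_scope.

Let mW : measurable_fun [set: S * S] (fun p => (W p)%:E).
Proof. by case: hW => mW _ _; exact/measurable_EFinP. Qed.

Let W0 p : 0 <= (W p)%:E.
Proof. by case: hW => _ W01 _; rewrite lee_fin; have /andP[] := W01 p. Qed.

Definition flow (A C : set S) := \int[mu \x mu]_(p in A `*` C) (W p)%:E.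

Lemma flowD A C : measurable A -> measurable C ->
  flow A C + flow C A = mu A * mu C.
Proof.
move=> mA mC; rewrite /flow -(@rect_integral_swap _ _ _ mu _ A C)//.
have mS : measurable_fun setT (fun p : S * S => (W (p.2, p.1))%:E).
  exact: (measurable_comp_swap mW).
have mAC : measurable (A `*` C) by exact: measurableX.
rewrite -ge0_integralD//; try exact: measurable_funTS.
rewrite (ge0_ae_eq_integral (g := cst 1))//.
- by rewrite integral_cst// mul1e; exact: product_measure1E.
- by apply: emeasurable_funD; exact: measurable_funTS.
- by move=> p _; rewrite adde_ge0.
- case: hW => _ _; apply: filterS => -[x y] /= W1 _.
  by rewrite -EFinD W1.
Qed.

(** Finiteness, read off from the finite sum in [flowD], lets later proofs pass to real numbers and
    conclude by [lra]. *)
Lemma flow_fin_num A C : measurable A -> measurable C -> flow A C \is a fin_num.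
Proof.
move=> mA mC; have := flowD mA mC.
have : mu A * mu C \is a fin_num by rewrite fin_numM// fin_num_measure.
by move=> /[swap] <-; rewrite fin_numD => /andP[].
Qed.

(** Integrating over [x] in [B] first leaves a function of [y] whose positivity set is
    [out_set mu W B] by definition. *)
Lemma flow_setC_eq0P B : measurable B ->
  flow B (~` B) = 0 <-> mu (out_set mu W B `\` B) = 0.
Proof.
move=> mB; rewrite /flow rect_tonelli2//; last exact: measurableC.
rewrite ge0_integral_eq0P//; first by rewrite setDE setIC.
- exact: measurableC.
- apply: measurable_funTS.
  exact: (measurable_fun_section_integral2 mu mW).
- by move=> y; exact: integral_ge0.
Qed.

Lemma flow_setTP B : measurable B ->
  flow B setT = mu B ^+ 2 * (2^-1)%:E <-> flow B (~` B) = 0.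
Proof.
move=> mB; have mCB := measurableC mB.
have -> : flow B setT = flow B B + flow B (~` B).
  rewrite /flow -ge0_integral_setU//=; try exact: measurableX.
  - congr (integral _ _ _); apply/seteqP; split=> -[x y] /=.
      by move=> [Bx _]; have [By|nBy] := pselect (B y); [left|right].
    by move=> [[]|[]].
  - exact: measurable_funTS.
  - apply/eqP/seteqP; split => // -[x y] /=.
    by move=> [[_ By] [_ nBy]].
have := flowD mB mB.
have /fineK <- := flow_fin_num mB mB.
have /fineK <- := flow_fin_num mB mCB.
have /fineK <- : mu B \is a fin_num by exact: fin_num_measure.
rewrite expe2 -!EFinM -!EFinD => -[BB]; split => -[] h; congr _%:E; lra.
Qed.

(** Both directions pass to the complement: [W] being 1 from [B] to its complement means that
    nothing flows back. *)
Lemma reducibleP : reducible mu W <->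
  exists B, [/\ measurable B, 0 < mu B < 1 & flow B (~` B) = 0].
Proof.
have CB B : measurable B -> 0 < mu B < 1 -> 0 < mu (~` B) < 1.
  move=> mB; have /fineK : mu B \is a fin_num by exact: fin_num_measure.
  rewrite probability_setC// => <-.
  by rewrite -EFinB !lte_fin => /andP[? ?]; apply/andP; split; lra.
split=> -[B [mB muB hB]]; exists (~` B); have mCB := measurableC mB;
    (split => //; [exact: CB|]); rewrite setCK.
  have mX : measurable (B `*` ~` B) by exact: measurableX.
  (* The flow out of [B] already equals the whole product of the measures, so [flowD] leaves 0 for
     the reverse flow. *)
  have := flowD mB mCB; rewrite {1}/flow (ge0_ae_eq_integral (g := cst 1))//.
  - rewrite integral_cst// mul1e.
    rewrite [X in X + _](_ : _ = mu B * mu (~` B)); last exact: product_measure1E.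
    have /fineK <- := flow_fin_num mCB mB.
    have /fineK <- : mu B \is a fin_num by exact: fin_num_measure.
    have /fineK <- : mu (~` B) \is a fin_num by exact: fin_num_measure.
    by rewrite -EFinM -EFinD => -[?]; congr _%:E; lra.
  - exact: measurable_funTS.
  - by apply: filterS hB => p h /h /= ->.
have mX : measurable (~` B `*` B) by exact: measurableX.
(* Swapping the integrand puts its a.e. vanishing in the coordinates of the goal, where the
   tournament identity applies at the same point. *)
have : \int[mu \x mu]_(p in ~` B `*` B) (W (p.2, p.1))%:E = 0.
  by rewrite -hB; exact: (@rect_integral_swap _ _ _ mu _ (~` B) B).
rewrite (eq_integral (fun p => `|(W (p.2, p.1))%:E|)); last first.
  by move=> p _; rewrite gee0_abs.
move=> /ae_eq_integral_abs -/(_ mX) h.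
have {}h : ae_eq (mu \x mu) (~` B `*` B) (fun p => (W (p.2, p.1))%:E) (cst 0).
  by apply: h; apply: measurable_funTS; exact: (measurable_comp_swap mW).
case: hW => _ _; apply: filterS2 h => -[x y] /= h W1 /h [].
by move=> h0; rewrite h0 addr0 in W1.
Qed.

(** * Out-neighbourhoods in terms of null sets, and reachable sets *)

Lemma out_setP B y : measurable B ->
  out_set mu W B y <-> mu (B `&` [set x | (0 < W (x, y))%R]) != 0.
Proof.
move=> mB; rewrite /out_set/= lt0e integral_ge0// andbT.
have := @ge0_integral_eq0P _ _ _ mu B (fun x => (W (x, y))%:E) mB.
rewrite (_ : [set x | 0 < (W (x, y))%:E] = [set x | (0 < W (x, y))%R]); last first.
  by apply/seteqP; split => x /=; rewrite lte_fin.
move=> /(_ (measurable_funTS (measurableT_comp mW (measurable_pair2 y)))).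
by move=> /(_ (fun=> W0 _))[h1 h2]; split; apply: contra => /eqP ?; apply/eqP; auto.
Qed.

Lemma measurable_out_set B : measurable B -> measurable (out_set mu W B).
Proof.
move=> mB; rewrite -[X in measurable X]setTI; apply: emeasurable_fun_o_infty => //.
exact: (measurable_fun_section_integral2 mu mW).
Qed.

Lemma measurable_out_pt x : measurable (out_pt W x).
Proof.
rewrite (_ : out_pt W x = setT `&` [set y | 0 < (W (x, y))%:E]).
  by apply: emeasurable_fun_o_infty => //; exact: measurableT_comp mW (measurable_pair1 x).
by apply/seteqP; split => y /=; rewrite lte_fin => // -[].
Qed.

Lemma measurable_in_pt y : measurable [set x | (0 < W (x, y))%R].
Proof.
rewrite (_ : [set x | _] = setT `&` [set x | 0 < (W (x, y))%:E]).
  by apply: emeasurable_fun_o_infty => //; exact: measurableT_comp mW (measurable_pair2 y).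
by apply/seteqP; split => x /=; rewrite lte_fin => // -[].
Qed.

Lemma measurable_iter_out_set n x :
  measurable (iter n (out_set mu W) (out_pt W x)).
Proof.
by elim: n => [|n IH]; [exact: measurable_out_pt|exact: measurable_out_set].
Qed.

(** Counting from 0 removes the predecessor in [out_pt_iter] together with the condition on the
    index. *)
Lemma reachableE x :
  reachable mu W x = \bigcup_n iter n (out_set mu W) (out_pt W x).
Proof.
apply/seteqP; split => y [n /= n1 yn]; first by exists n.-1.
by exists n.+1.
Qed.

Lemma measurable_reachable x : measurable (reachable mu W x).
Proof.
by rewrite reachableE; apply: bigcupT_measurable => n; exact: measurable_iter_out_set.
Qed.

Lemma out_pt_reachable x : out_pt W x `<=` reachable mu W x.
Proof. by rewrite reachableE => y xy; exists 0%N. Qed.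

(** If [y] has a non-null set of in-neighbours in a countable union, then it has one in some
    iterate, and so lies in the next iterate. *)
Lemma out_set_reachable x :
  out_set mu W (reachable mu W x) `<=` reachable mu W x.
Proof.
have mR := measurable_reachable x.
move=> y /(out_setP _ mR); apply: contraPP => nRy.
apply/negP; rewrite negbK; apply/eqP; apply: measure_negligible.
  by apply: measurableI => //; exact: measurable_in_pt.
rewrite reachableE setI_bigcupl; apply: negligible_bigcup => n.
have mn := measurable_iter_out_set n x.
apply/negligibleP; first by apply: measurableI => //; exact: measurable_in_pt.
apply/eqP; apply: contra_notT nRy => /(out_setP _ mn) yn.
by rewrite reachableE; exists n.+1.
Qed.

Lemma out_pt_neq0_ae : {ae mu, forall x, mu (out_pt W x) != 0}.
Proof.
(* Having no out-neighbours up to a null set is expressed by an integral, so that [Z] is measurable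
   by Tonelli. *)
pose Z := ~` [set x | 0 < \int[mu]_y (W (x, y))%:E].
have mZ : measurable Z.
  apply: measurableC; rewrite -[X in measurable X]setTI.
  apply: emeasurable_fun_o_infty => //.
  exact: (measurable_fun_section_integral1 mu mW).
exists Z; split => //.
- have Z0 : flow Z Z = 0.
    rewrite /flow rect_tonelli1//; apply: integral0_eq => x /negP.
    rewrite -leNgt => Zx; apply/eqP; rewrite eq_le integral_ge0// andbT.
    apply: le_trans Zx; apply: ge0_subset_integral => //.
    exact: measurableT_comp mW (measurable_pair1 x).
  have := flowD mZ mZ; rewrite Z0 adde0 => /esym/eqP.
  by rewrite mule_eq0 orbb => /eqP.
move=> x /= /negP; rewrite negbK => /eqP x0 /=.
apply/negP; rewrite -leNgt le_eqVlt; apply/orP; left; apply/eqP.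
apply/ge0_integral_eq0P => //; first exact: measurableT_comp mW (measurable_pair1 x).
by rewrite setTI -[RHS]x0.
Qed.

(** * Irreducibility, strong connectedness and sets without outward flow *)

Lemma irreducible_strongly_connected :
  irreducible mu W -> strongly_connected mu W.
Proof.
move=> irr; apply: filterS out_pt_neq0_ae => x x0.
have mR := measurable_reachable x.
apply/eqP; rewrite eq_le probability_le1//= leNgt; apply/negP => R1.
apply: irr; apply/reducibleP; exists (reachable mu W x); split => //.
  rewrite R1 andbT lt0e measure_ge0 andbT; apply: contra x0 => /eqP R0.
  apply/eqP; apply: subset_measure0 R0 => //; first exact: measurable_out_pt.
  exact: out_pt_reachable.
apply/flow_setC_eq0P => //.
rewrite (_ : _ `\` _ = set0) ?measure0//.
by rewrite setD_eq0; exact: out_set_reachable.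
Qed.

(** By induction each iterate lies in [B] up to a null set, and countably many null sets add up to a
    null set. *)
Lemma reachable_setD_eq0 B x : measurable B ->
  mu (out_set mu W B `\` B) = 0 -> mu (out_pt W x `\` B) = 0 ->
  mu (reachable mu W x `\` B) = 0.
Proof.
move=> mB NB xB; apply: measure_negligible.
  by apply: measurableD => //; exact: measurable_reachable.
rewrite reachableE setDE setI_bigcupl; apply: negligible_bigcup => n.
have mn k := measurable_iter_out_set k x.
rewrite -setDE; apply/negligibleP; first exact: measurableD.
elim: n => //= n IH.
have mo := measurable_out_set.
apply: subset_measure0 NB; [exact/measurableD/mB/mo/mn|exact/measurableD/mB/mo/mB|].
(* This inclusion holds at every [y]: by [out_setP], [out_set] ignores null sets, and the iterate
   exceeds [B] only by a null set. *)
apply: setSD => y /(out_setP _ (mn n)) yn; apply/(out_setP _ mB).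
have mI := measurable_in_pt y.
apply: contra yn => /eqP yB; apply/eqP; apply: measure_negligible.
  exact: measurableI.
have : mu.-negligible ((iter n (out_set mu W) (out_pt W x) `\` B) `|`
                       (B `&` [set x0 | (0 < W (x0, y))%R])).
  by apply: negligibleU; apply/negligibleP => //; [exact: measurableD|exact: measurableI].
apply: negligibleS => z [zn zy].
by have [Bz|nBz] := pselect (B z); [right|left].
Qed.

Lemma strongly_connected_no_closed : strongly_connected mu W ->
  ~ exists B, [/\ measurable B, 0 < mu B < 1 & mu (out_set mu W B `\` B) = 0].
Proof.
move=> sc [B [mB /andP[B0 B1] NB]]; have mCB := measurableC mB.
(* The flow out of [B] is zero; integrating over [y] first shows that almost every single point of
   [B] sends nothing outside. *)
have BN : mu (B `&` [set x | 0 < \int[mu]_(y in ~` B) (W (x, y))%:E]) = 0.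
  have := (flow_setC_eq0P mB).2 NB.
  rewrite /flow rect_tonelli1// => /ge0_integral_eq0P; apply => //.
  - by apply: measurable_funTS; exact: (measurable_fun_section_integral1 mu mW).
  - by move=> x; exact: integral_ge0.
(* Since [B] is not null, it has a point outside both exceptional null sets. *)
have [x [Bx xN xR]] : exists x, [/\ B x,
    ~ 0 < \int[mu]_(y in ~` B) (W (x, y))%:E & mu (reachable mu W x) = 1].
  apply: contrapT => nx; move: B0; rewrite lt0e => /andP[/eqP + _]; apply.
  apply: measure_negligible => //.
  have : mu.-negligible (~` [set x | mu (reachable mu W x) = 1] `|`
      B `&` [set x | 0 < \int[mu]_(y in ~` B) (W (x, y))%:E]).
    apply: negligibleU; first exact: sc.
    apply/negligibleP => //; apply: measurableI => //.
    rewrite -[X in measurable X]setTI; apply: emeasurable_fun_o_infty => //.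
    exact: (measurable_fun_section_integral1 mu mW).
  apply: negligibleS => x Bx /=.
  by apply: contrapT => /not_orP[/contrapT ? /not_andP[//|?]]; apply: nx; exists x.
have xB : mu (out_pt W x `\` B) = 0.
  rewrite setDE setIC.
  have -> : out_pt W x = [set y | 0 < (W (x, y))%:E].
    by apply/seteqP; split => y /=; rewrite lte_fin.
  apply/ge0_integral_eq0P => //.
    by apply: measurable_funTS; exact: measurableT_comp mW (measurable_pair1 x).
  by apply/eqP; rewrite eq_le integral_ge0// andbT leNgt; apply/negP.
have mR := measurable_reachable x.
have := reachable_setD_eq0 mB NB xB.
(* The 1 in [mu B < 1] becomes the measure of the reachable set, which is at most [mu B] as that set
   lies in [B] up to a null set. *)
move: B1; rewrite -xR => /[swap] RB.
rewrite ltNge => /negP; apply.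
rewrite (measureDI mu mR mB) [X in X + _ <= _]RB add0e.
by apply: le_measure; rewrite ?inE//; exact: measurableI.
Qed.

End tournament_kernel.

Theorem theorem8p2 (d : measure_display) (S : measurableType d)
    (R : realType) (mu : probability S R) (W : S * S -> R)
    (hW : tournament_kernel mu W) :
  [<-> irreducible mu W;
       strongly_connected mu W;
       ~ (exists B : set S,
            [/\ measurable B, (0 < mu B < 1)%E &
                mu (out_set mu W B `\` B) = 0%E]);
       ~ (exists B : set S,
            [/\ measurable B, (0 < mu B < 1)%E &
                (\int[(mu \x mu)%E]_(p in B `*` [set: S]) (W p)%:E
                 = mu B ^+ 2 * (2^-1)%:E)%E])].
Proof.
tfae.
- exact: irreducible_strongly_connected.
- exact: strongly_connected_no_closed.
- apply: contra_not => -[B [mB B01 hB]]; exists B; split => //.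
  exact/(flow_setC_eq0P hW mB)/(flow_setTP hW mB).
(* The [B] given by [reducibleP] is the complement of the set witnessing reducibility. *)
- apply: contra_not => /(reducibleP hW)[B [mB B01 hB]]; exists B; split => //.
  exact/(flow_setTP hW mB).
Qed.
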